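(* Let $G\in\mathbb{C}^{\mathcal I\times\mathcal I}$ be a $\mathcal{DH}^2$-matrix for a cluster tree $\mathcal T_{\mathcal I}$, a family of directions and a block tree $\mathcal T_{\mathcal I\times\mathcal I}$, with row cluster basis $(V_{tc})$, column cluster basis $(W_{tc})$, both of rank $k$, and coupling matrices $(S_b)_{b\in\mathcal L^+_{\mathcal I\times\mathcal I}}$, where $\kappa\ge 0$ is the wave number and $p_{\mathcal I}$ the depth of $\mathcal T_{\mathcal I}$, and let the regularity assumptions listed in the context hold. Then there are constants $C_{bw},C_{we},C_{tr},C_{pr}\in\mathbb{R}_{>0}$, depending only on the constants $C_{cp},C_{nc},C_{cu},C_{cl},C_{ov},C_{lf},C_{rs},C_{un},C_{di},C_{sp},C_{lv},C_{qr},C_{svd},C_{rk}$ and on $|\Omega|$ (in particular not on $\#\mathcal I$, $k$, $\kappa$ or $p_{\mathcal I}$), such that the number of operations of the basis weight phase, of the total weight phase, of the truncation phase (each for one cluster basis), and of the projection phase is at most $C_{bw}$, $C_{we}$, $C_{tr}$, and $C_{pr}$, respectively, times $k^3\left(\frac{\#\mathcal I}{k}+(p_{\mathcal I}+1)\kappa^2\right)$, and the entire recompression algorithm (basis weights and total weights for the row and the column cluster basis, truncation of both bases, projection of the coupling matrices) requires not more than $$(2C_{bw}+2C_{we}+2C_{tr}+C_{pr})\,k^3\left(\frac{\#\mathcal I}{k}+(p_{\mathcal I}+1)\kappa^2\right)$$ operations.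
   Context: **Cluster tree.** $\Omega\subseteq\mathbb{R}^3$ is a surface with surface measure $|\cdot|$, $\kappa\ge0$ is the wave number, $\mathcal I$ is a finite index set, $(\varphi_i)_{i\in\mathcal I}$ are basis functions on $\Omega$. A cluster tree $\mathcal T_{\mathcal I}$ is a finite tree whose nodes $t$ (clusters) carry labels $\hat t\subseteq\mathcal I$ such that the root has label $\mathcal I$ and, whenever the set $\mathrm{chil}(t)$ of children of $t$ is nonempty, $\hat t$ is the disjoint union of the $\hat t'$, $t'\in\mathrm{chil}(t)$. $\mathcal L_{\mathcal I}$ is the set of leaves, $\mathcal T_{\mathcal I}^{(\ell)}$ the set of clusters on level $\ell$ (the root has level $0$), $p_{\mathcal I}$ the maximal level. Each cluster $t$ has an axis-parallel bounding box $B_t\subseteq\mathbb{R}^3$ with midpoint $m_t$ and $\mathrm{supp}\,\varphi_i\subseteq B_t$ for all $i\in\hat t$; boxes on the same level are identical up to translation. **Directions.** For every level $\ell\in\{0,\dots,p_{\mathcal I}\}$, $\mathcal D_\ell\subset\mathbb{R}^3$ is a finite set with $\|c\|=1$ or $c=0$ for all $c\in\mathcal D_\ell$. $\mathrm{sd}_\ell:\mathcal D_\ell\to\mathcal D_{\ell+1}$ maps $c$ to a closest element of $\mathcal D_{\ell+1}$. For $t\in\mathcal T_{\mathcal I}^{(\ell)}$, $\mathcal D_t:=\mathcal D_\ell$, $\mathrm{sd}_t:=\mathrm{sd}_\ell$. For $t,s$ on the same level $\ell$, $c_{ts}\in\mathcal D_\ell$ is a best approximation in $\mathcal D_\ell$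 of $(m_t-m_s)/\|m_t-m_s\|$ (arbitrary if $m_t=m_s$). With a parameter $\eta_1>0$ it is assumed that $\min_{c\in\mathcal D_t}\|y-c\|\le\eta_1/(\kappa\,\mathrm{diam}(B_t))$ for all $t$ and all unit vectors $y$. **Block tree.** With a parameter $\eta_2>0$, a pair $(t,s)$ is admissible if $\max\{\mathrm{diam}(B_t),\mathrm{diam}(B_s)\}\le\eta_2\,\mathrm{dist}(B_t,B_s)$ and $\kappa\max\{\mathrm{diam}(B_t)^2,\mathrm{diam}(B_s)^2\}\le\eta_2\,\mathrm{dist}(B_t,B_s)$. The block tree $\mathcal T_{\mathcal I\times\mathcal I}$ has nodes $(t,s,c_{ts})$; its root is $(r,r,c_{rr})$ with $r$ the root of $\mathcal T_{\mathcal I}$; a node with $(t,s)$ admissible is a leaf; a non-admissible node with $\mathrm{chil}(t)=\emptyset$ or $\mathrm{chil}(s)=\emptyset$ is a leaf; every other node has the children $(t',s',c_{t's'})$, $t'\in\mathrm{chil}(t)$, $s'\in\mathrm{chil}(s)$. $\mathcal L^+_{\mathcal I\times\mathcal I}$ is the set of admissible leaves, and $\mathrm{row}(t,c):=\{s:(t,s,c)\in\mathcal L^+_{\mathcal I\times\mathcal I}\}$. **$\mathcal{DH}^2$-matrix.** A directional cluster basis of rank $k\in\mathbb{N}$ is a family $V=(V_{tc})_{t\in\mathcal T_{\mathcal I},c\in\mathcal D_t}$, $V_{tc}\in\mathbb{C}^{\hat t\times k}$, with transfer matrices $E_{t'c}\in\mathbb{C}^{k\times k}$ such that $V_{tc}|_{\hat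 t'\times k}=V_{t'c'}E_{t'c}$ for all $t$, $t'\in\mathrm{chil}(t)$, $c\in\mathcal D_t$, $c'=\mathrm{sd}_t(c)$. It is represented by the $V_{tc}$ for leaves $t$ and the transfer matrices. $G$ is a $\mathcal{DH}^2$-matrix with row basis $V$ and column basis $W$ (both directional cluster bases) if there are coupling matrices $S_b\in\mathbb{C}^{k\times k}$ with $G|_{\hat t\times\hat s}=V_{tc}S_bW_{sc}^*$ for all $b=(t,s,c)\in\mathcal L^+_{\mathcal I\times\mathcal I}$. **Regularity assumptions.** There are positive constants such that - $\mathrm{diam}(B_t)\le C_{cp}\,\mathrm{diam}(B_{t'})$ for $t'\in\mathrm{chil}(t)$; $\#\mathrm{chil}(t)\le C_{nc}$ and $\#\mathrm{chil}(t)\ne1$ for all $t$; - $|\Omega\cap\mathcal B(x,r)|\le C_{cu}r^2$ for all balls with center $x\in\mathbb{R}^3$ and radius $r\ge0$; $\mathrm{diam}^2(B_t)\le C_{cl}|B_t\cap\Omega|$ for all $t$; $\#\{t\in\mathcal T^{(\ell)}_{\mathcal I}:x\in B_t\}\le C_{ov}$ for all $x\in\Omega$ and all $\ell$; - $C_{lf}\,\kappa\,\mathrm{diam}(B_t)\le1$ and $C_{rs}^{-1}k\le\#\hat t\le C_{rs}k$ for all leaves $t$; - for a leaf $t$ and a cluster $s$ on the same level, $\eta_2\,\mathrm{dist}(B_t,B_s)<\mathrm{diam}(B_t)$ implies $\#\hat s\le C_{un}\#\hat t$; - $\#\mathcal D_t\le C_{di}(1+\kappa^2\mathrm{diam}^2(B_t))$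 for all $t$. Known consequences that may be taken as given: there are constants $C_{sp},C_{lv}>0$ such that, for all $t$, $\sum_{c\in\mathcal D_t}\#\mathrm{row}(t,c)\le C_{sp}$ if $C_{cp}\kappa\,\mathrm{diam}(B_t)<1$ and $\le C_{sp}\kappa^2\mathrm{diam}(B_t)^2$ otherwise; $\#\mathcal T^{(\ell)}_{\mathcal I}\le C_{lv}|\Omega|/\mathrm{diam}^2(B_t)$ for all $\ell$ and $t\in\mathcal T^{(\ell)}_{\mathcal I}$; $\#\mathcal T_{\mathcal I}\le C_{lv}\#\mathcal I/k$. **Cost model.** Multiplying an $m\times n$ by an $n\times p$ matrix costs at most $2mnp$ operations. A thin QR factorization $A=PR$ ($P$ isometric, i.e. $P^*P=I$, $R$ with $\min\{m,n\}$ rows) of $A\in\mathbb{C}^{m\times n}$ costs at most $C_{qr}mn\min\{m,n\}$, its singular value decomposition at most $C_{svd}mn\min\{m,n\}$ operations. Choosing a truncation rank by inspecting singular values costs at most $C_{rk}k$ operations per pair $(t,c)$. **Recompression algorithm (row basis).** 1. Basis weights of $W$ (bottom-up over the tree): for a leaf $t$ and $c\in\mathcal D_t$, $R_{W,tc}$ is the $R$-factor of a thin QR factorization of $W_{tc}$; for a non-leaf $t$, $R_{W,tc}$ is the $R$-factor of a thin QR factorization of the matrix obtained by stacking vertically the products of $R_{W,t'c'}$, $c'=\mathrm{sd}_t(c)$, with the transfer matrix of $W$ for $(t',c)$, over all $t'\in\mathrm{chil}(t)$. Thus $W_{tc}=P_{W,tc}R_{W,tc}$ with isometric $P_{W,tc}$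 (not computed). 2. Total weights of $V$ (top-down): for $t$ with parent $t^+$, $c\in\mathcal D_t$, let $Z_{tc}$ be the matrix with $k$ rows consisting side by side of the blocks $S_{(t,s,c)}R_{W,sc}^*$, $s\in\mathrm{row}(t,c)$, and the blocks $E_{tc^+}\widehat Z_{t^+c^+}^*$, $c^+\in\mathrm{sd}_{t^+}^{-1}(\{c\})$ (for the root only the former); $\widehat Z_{tc}$ is the $R$-factor of a thin QR factorization of $Z_{tc}^*$. 3. Truncation of $V$ (bottom-up), with $\widehat V_{tc}:=V_{tc}$ for leaves and $\widehat V_{tc}$ the vertical stack of $C_{t'c'}E_{t'c}$, $t'\in\mathrm{chil}(t)$, $c'=\mathrm{sd}_t(c)$, for non-leaves: compute the singular value decomposition of $\widehat V_{tc}\widehat Z_{tc}^*$, choose a rank $k_{tc}$ (at most the number of singular values), let $\widehat Q_{tc}$ consist of the first $k_{tc}$ left singular vectors, and compute $C_{tc}:=\widehat Q_{tc}^*\widehat V_{tc}$. For leaves $Q_{tc}:=\widehat Q_{tc}$; for non-leaves the row blocks of $\widehat Q_{tc}$ are the transfer matrices of the new basis $(Q_{tc})$. One has $C_{tc}=Q_{tc}^*V_{tc}$. The column basis is treated by applying steps 1–3 to $G^*$ (roles of $V$ and $W$ exchanged). Projection phase: for all $b=(t,s,c)\in\mathcal L^+_{\mathcal I\times\mathcal I}$ compute $\widetilde S_b:=(C_{tc}S_b)C_{sc}^*$, where $C_{tc}$ is the basis-change matrix for the row basis and $C_{sc}$ the one for the column basis. *)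

(* Defs.v *)
From HB Require Import structures.
From mathcomp Require Import all_boot all_order all_algebra.
From mathcomp Require Import finmap complex.
From mathcomp Require Import all_classical all_reals all_analysis.

Set Implicit Arguments.
Unset Strict Implicit.
Unset Printing Implicit Defensive.

Import Order.TTheory GRing.Theory Num.Theory.
Import numFieldNormedType.Exports.

Local Open Scope classical_set_scope.
Local Open Scope ring_scope.
Local Open Scope sesquilinear_scope.

Notation vec3 R := 'rV[R]_3.

Section Geometry.
Variable R : realType.
Implicit Types (A B Omega : set (vec3 R)) (x y lo hi : vec3 R).

(* The library norm on 'rV is the maximum norm, hence this definition. *)
Definition enorm x : R := Num.sqrt (\sum_i x ord0 i ^+ 2).

Definition diam A : R :=
  sup [set d | exists x y, [/\ A x, A y & d = enorm (x - y)]].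

Definition dist A B : R :=
  inf [set d | exists x y, [/\ A x, B y & d = enorm (x - y)]].

Definition closed_eball x (r : R) : set (vec3 R) :=
  [set y | enorm (y - x) <= r].

Definition hausdorff2_delta (d : R) A : \bar R :=
  ereal_inf [set v | exists U : nat -> set (vec3 R),
    [/\ A `<=` \bigcup_j U j,
        (forall j x y, U j x -> U j y -> enorm (x - y) <= d) &
        v = (\sum_(0 <= j <oo) (pi / 4 * diam (U j) ^+ 2)%:E)%E]].

(* Surface measure: two-dimensional Hausdorff measure, where the factor pi / 4
   makes it agree with the surface area. *)
Definition surface_measure A : \bar R :=
  ereal_sup [set hausdorff2_delta d A | d in [set d : R | 0 < d]].

(* A surface, possibly with boundary: locally homeomorphic to relatively open
   subsets of a closed half-plane. *)
Definition is_surface Omega : Prop :=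
  forall x, Omega x ->
  exists (U : set (vec3 R)) (D : set 'rV[R]_2)
         (f : 'rV[R]_2 -> vec3 R) (g : vec3 R -> 'rV[R]_2),
  let M := U `&` Omega in
  let H := D `&` [set u | 0 <= u ord0 ord0] in
  [/\ open U /\ U x, open D, f @` H = M,
      (forall u, H u -> g (f u) = u) &
      {within H, continuous f} /\ {within M, continuous g}].

Definition box lo hi : set (vec3 R) :=
  [set x | forall i, lo ord0 i <= x ord0 i <= hi ord0 i].

End Geometry.

(* [level_parent] together with [level_root] makes the parent map acyclic. *)
Record cluster_tree (I : finType) := ClusterTree {
  clusters : finType;
  tree_root : clusters;
  parent : clusters -> option clusters;
  level : clusters -> nat;
  label : clusters -> {set I};
  parent_root : parent tree_root = None;
  parent_None : forall t, parent t = None -> t = tree_root;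
  level_root : level tree_root = 0%N;
  level_parent : forall t u, parent t = Some u -> level t = (level u).+1;
  label_root : label tree_root = [set: I]%SET;
  label_union : forall t, (exists t', parent t' = Some t) ->
    label t = (\bigcup_(t' | parent t' == Some t) label t')%SET;
  label_disjoint : forall t t1 t2, parent t1 = Some t -> parent t2 = Some t ->
    t1 != t2 -> (label t1 :&: label t2)%SET = finset.set0
}.

Section ClusterTree.
Variables (I : finType) (T : cluster_tree I).
Implicit Types t : clusters T.

Definition chil t : {set clusters T} := [set t' | parent t' == Some t]%SET.
Definition is_leaf t : bool := chil t == finset.set0.
Definition on_level l : {set clusters T} := [set t | level t == l :> nat]%SET.
Definition depth : nat := (\max_(t : clusters T) level t)%N.

End ClusterTree.

(* [dirs l] is the set of directions D_l, [sd l] the map sd_l from D_l to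
   D_(l+1), and [cdir t s] the direction c_ts.  These are total functions;
   [wf_setting] constrains them for the relevant levels, directions and
   clusters only. *)
Record setting (R : realType) (I : finType) := Setting {
  tree : cluster_tree I;
  kappa : R;
  eta1 : R;
  eta2 : R;
  Omega : set (vec3 R);
  phi : I -> vec3 R -> R[i];
  lo : clusters tree -> vec3 R;
  hi : clusters tree -> vec3 R;
  dirs : nat -> {fset vec3 R};
  sd : nat -> vec3 R -> vec3 R;
  cdir : clusters tree -> clusters tree -> vec3 R
}.

Section Constants.
Variable R : realType.

Record constants := Constants {
  Ccp : R; Cnc : R; Ccu : R; Ccl : R; Cov : R; Clf : R; Crs : R; Cun : R;
  Cdi : R; Csp : R; Clv : R; Cqr : R; Csvd : R; Crk : R
}.

Definition constants_pos (C : constants) : Prop :=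
  [/\ [/\ 0 < Ccp C, 0 < Cnc C, 0 < Ccu C, 0 < Ccl C & 0 < Cov C],
      [/\ 0 < Clf C, 0 < Crs C, 0 < Cun C & 0 < Cdi C],
      0 < Csp C /\ 0 < Clv C &
      [/\ 0 < Cqr C, 0 < Csvd C & 0 < Crk C]].

End Constants.

Section Setting.
Variables (R : realType) (I : finType) (X : setting R I).
Local Notation cl := (clusters (tree X)).
Local Notation rt := (tree_root (tree X)).
Implicit Types (t s : cl) (c : vec3 R).

Definition bbox t : set (vec3 R) := box (lo t) (hi t).
Definition mid t : vec3 R := 2^-1 *: (lo t + hi t).
Definition dirs_of t : {fset vec3 R} := dirs X (level t).
Definition sd_of t : vec3 R -> vec3 R := sd X (level t).

Definition supp_phi (i : I) : set (vec3 R) :=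
  closure [set x | Omega X x /\ phi X i x != 0].

(* In [directions_fine] the bound eta1 / (kappa * diam) is multiplied out, so
   that it is void (apart from nonemptiness) when kappa * diam = 0. *)
Record wf_setting : Prop := WfSetting {
  kappa_ge0 : 0 <= kappa X;
  eta1_gt0 : 0 < eta1 X;
  eta2_gt0 : 0 < eta2 X;
  Omega_surface : is_surface (Omega X);
  box_le : forall t i, lo t ord0 i <= hi t ord0 i;
  box_supp : forall t i, i \in label t -> supp_phi i `<=` bbox t;
  box_translate : forall t s, level t = level s ->
    exists v, bbox s = [set x + v | x in bbox t];
  dirs_unit : forall l c, (l <= depth (tree X))%N -> c \in dirs X l ->
    enorm c = 1 \/ c = 0;
  sd_dirs : forall l c, (l < depth (tree X))%N -> c \in dirs X l ->
    sd X l c \in dirs X l.+1;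
  sd_closest : forall l c c', (l < depth (tree X))%N -> c \in dirs X l ->
    c' \in dirs X l.+1 -> enorm (c - sd X l c) <= enorm (c - c');
  cdir_dirs : forall t s, level t = level s -> cdir t s \in dirs_of t;
  cdir_best : forall t s c, level t = level s -> mid t != mid s ->
    c \in dirs_of t ->
    let y := (enorm (mid t - mid s))^-1 *: (mid t - mid s) in
    enorm (y - cdir t s) <= enorm (y - c);
  directions_fine : forall t (y : vec3 R), enorm y = 1 ->
    exists2 c, c \in dirs_of t &
      kappa X * diam (bbox t) * enorm (y - c) <= eta1 X
}.

Definition admissible t s : bool :=
  (Num.max (diam (bbox t)) (diam (bbox s))
     <= eta2 X * dist (bbox t) (bbox s)) &&
  (kappa X * Num.max (diam (bbox t) ^+ 2) (diam (bbox s) ^+ 2)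
     <= eta2 X * dist (bbox t) (bbox s)).

Inductive block_node : cl -> cl -> vec3 R -> Prop :=
| block_root : block_node rt rt (cdir rt rt)
| block_chil t s c t' s' : block_node t s c -> ~~ admissible t s ->
    t' \in chil t -> s' \in chil s -> block_node t' s' (cdir t' s').

Definition adm_leaf t s c : Prop := block_node t s c /\ admissible t s.

Definition row_blocks t c : {set cl} := [set s | `[< adm_leaf t s c >]]%SET.

(* The blocks of the adjoint of G are the (s, t, c) with (t, s, c) a block of
   G; [col_blocks] is therefore what
   [row_blocks] becomes for the adjoint. *)
Definition col_blocks s c : {set cl} := [set t | `[< adm_leaf t s c >]]%SET.

Record regular (C : constants R) (k : nat) : Prop := Regular {
  reg_cp : forall t t', t' \in chil t ->
    diam (bbox t) <= Ccp C * diam (bbox t');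
  reg_nc : forall t, #|chil t|%:R <= Cnc C;
  reg_chil1 : forall t, #|chil t| <> 1%N;
  reg_cu : forall x r, 0 <= r ->
    (surface_measure (Omega X `&` closed_eball x r) <= (Ccu C * r ^+ 2)%:E)%E;
  reg_cl : forall t, ((diam (bbox t) ^+ 2)%:E
    <= (Ccl C)%:E * surface_measure (bbox t `&` Omega X))%E;
  reg_ov : forall l x, Omega X x ->
    #|[set t in on_level (tree X) l | x \in bbox t]%SET|%:R <= Cov C;
  reg_lf : forall t, is_leaf t -> Clf C * kappa X * diam (bbox t) <= 1;
  reg_rs : forall t, is_leaf t ->
    (Crs C)^-1 * k%:R <= #|label t|%:R <= Crs C * k%:R;
  reg_un : forall t s, is_leaf t -> level t = level s ->
    eta2 X * dist (bbox t) (bbox s) < diam (bbox t) ->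
    #|label s|%:R <= Cun C * #|label t|%:R;
  reg_di : forall t, #|` dirs_of t |%:R
    <= Cdi C * (1 + kappa X ^+ 2 * diam (bbox t) ^+ 2)
}.

(* [area] is the (finite) surface measure of Omega. *)
Record known_consequences (C : constants R) (area : R) (k : nat) : Prop :=
  KnownConsequences {
  known_sp : forall t, (\sum_(c <- dirs_of t) #|row_blocks t c|)%N%:R
    <= if Ccp C * kappa X * diam (bbox t) < 1 then Csp C
       else Csp C * (kappa X ^+ 2 * diam (bbox t) ^+ 2);
  known_level : forall l t, t \in on_level (tree X) l ->
    #|on_level (tree X) l|%:R * diam (bbox t) ^+ 2 <= Clv C * area;
  known_lv : #|cl|%:R <= Clv C * (#|I|%:R / k%:R)
}.

(* Rows are indexed by the canonical enumeration of the label of t;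
   [transfer t' c] is E_(t'c), where t' is a child of t and c a direction
   of t. *)
Record cluster_basis (k : nat) := ClusterBasis {
  basis : forall t, vec3 R -> 'M[R[i]]_(#|label t|, k);
  transfer : cl -> vec3 R -> 'M[R[i]]_k
}.

Definition is_directional k (V : cluster_basis k) : Prop :=
  forall t t' c, t' \in chil t -> c \in dirs_of t ->
  forall (i : 'I_#|label t|) (i' : 'I_#|label t'|),
    enum_val i = enum_val i' ->
    row i (basis V t c) = row i' (basis V t' (sd_of t c) *m transfer V t' c).

Definition is_dh2 k (G : I -> I -> R[i]) (V W : cluster_basis k)
    (S : cl -> cl -> vec3 R -> 'M[R[i]]_k) : Prop :=
  forall t s c, adm_leaf t s c ->
  \matrix_(i < #|label t|, j < #|label s|) G (enum_val i) (enum_val j)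
    = basis V t c *m S t s c *m (basis W s c)^t*.

(* [f a ops] means that the (nondeterministic) computation [f] may return [a]
   after performing exactly [ops] arithmetic operations. *)
Definition comp (A : Type) : Type := A -> nat -> Prop.

Definition ret A (a : A) : comp A := fun b ops => b = a /\ ops = 0%N.

Definition bind A B (f : comp A) (g : A -> comp B) : comp B :=
  fun b ops => exists a ops1 ops2,
    [/\ f a ops1, g a b ops2 & ops = (ops1 + ops2)%N].

Notation "'let*' x := f 'in' g" := (bind f (fun x => g))
  (at level 200, x name, f at level 200, g at level 200).

(* Performs [f j] once for every entry j of s. *)
Definition each (J : eqType) (s : seq J) (A : J -> Type)
    (f : forall j, comp (A j)) : comp (forall j, A j) :=
  fun a ops => exists2 cost : J -> nat,
    forall j, j \in s -> f j (a j) (cost j) &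
    ops = (\sum_(j <- s) cost j)%N.

(* A recursion over the entries of s: the computation [step a j] for entry j
   may use the results [a j'] for other entries.  Below, steps refer only to
   the children (bottom-up) or only to the parent (top-down) of a cluster, so
   that the order of evaluation is forced by the tree. *)
Definition recursion (J : eqType) (s : seq J) (A : Type)
    (step : (J -> A) -> J -> comp A) : comp (J -> A) :=
  fun a ops => each s (step a) a ops.

Definition vstack (J : Type) (s : seq J) (r : J -> nat) n
    (Y : forall j, 'M[R[i]]_(r j, n)) :=
  \mxcol_(i < size s) Y (tnth (in_tuple s) i).

Definition hstack (J : Type) (s : seq J) (r : J -> nat) m
    (Y : forall j, 'M[R[i]]_(m, r j)) :=
  \mxrow_(i < size s) Y (tnth (in_tuple s) i).

(* Matrices with k columns and an arbitrary number of rows. *)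
Definition rowsmx k := {m : nat & 'M[R[i]]_(m, k)}.
Definition rows k (A : rowsmx k) : nat := tag A.
Definition mx k (A : rowsmx k) : 'M[R[i]]_(rows A, k) := tagged A.
Definition pack m k (A : 'M[R[i]]_(m, k)) : rowsmx k :=
  Tagged (fun m => 'M[R[i]]_(m, k)) A.

Definition isometric m n (P : 'M[R[i]]_(m, n)) : Prop := P^t* *m P = 1%:M.

Section Algorithm.
Variables (C : constants R) (k : nat).
Local Notation cmx := (cluster_basis k).
Local Notation node := (cl * vec3 R)%type.

Definition mul m n p (A : 'M[R[i]]_(m, n)) (B : 'M[R[i]]_(n, p)) :
    comp 'M[R[i]]_(m, p) :=
  fun D ops => D = A *m B /\ (ops <= 2 * m * n * p)%N.

Definition thin_qr m n (A : 'M[R[i]]_(m, n)) : comp (rowsmx n) :=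
  fun D ops =>
    [/\ rows D = minn m n,
        exists2 P : 'M[R[i]]_(m, rows D), isometric P & A = P *m mx D &
        ops%:R <= Cqr C * (m * n * minn m n)%:R].

(* Left singular vectors and singular values. *)
Definition svd m n (A : 'M[R[i]]_(m, n)) :
    comp ('M[R[i]]_(m, minn m n) * 'rV[R]_(minn m n)) :=
  fun Us ops =>
    [/\ isometric Us.1,
        (forall i, 0 <= Us.2 ord0 i),
        (forall i j : 'I_(minn m n), (i <= j)%N -> Us.2 ord0 j <= Us.2 ord0 i),
        exists2 B : 'M[R[i]]_(n, minn m n), isometric B &
          A = Us.1 *m diag_mx (map_mx (real_complex R) Us.2) *m B^t* &
        ops%:R <= Csvd C * (m * n * minn m n)%:R].

Definition choose_rank q (sigma : 'rV[R]_q) : comp 'I_q.+1 :=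
  fun _ ops => ops%:R <= Crk C * k%:R.

Definition first_cols m q (r : 'I_q.+1) (U : 'M[R[i]]_(m, q)) :
    'M[R[i]]_(m, r) :=
  colsub (widen_ord (leq_ord r)) U.

Definition nodes : seq node := [seq (t, c) | t <- enum cl, c <- dirs_of t].

Definition basis_weights (W : cmx) : comp (node -> rowsmx k) :=
  recursion nodes (fun RW tc => let: (t, c) := tc in
    if is_leaf t then thin_qr (basis W t c)
    else
      let* Y := each (enum (chil t)) (fun t' =>
        mul (mx (RW (t', sd_of t c))) (transfer W t' c)) in
      thin_qr (vstack (enum (chil t)) Y)).

(* The phases below are stated for an arbitrary set of blocks
   [blocks t c] = {s | (t, s, c) is a block}, so that they apply both to G and
   to its adjoint. *)
Definition total_weights (blocks : cl -> vec3 R -> {set cl})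
    (S : cl -> cl -> vec3 R -> 'M[R[i]]_k) (V : cmx)
    (RW : node -> rowsmx k) : comp (node -> rowsmx k) :=
  recursion nodes (fun Z tc => let: (t, c) := tc in
    let ss := enum (blocks t c) in
    let* Y := each ss (fun s => mul (S t s c) ((mx (RW (s, c)))^t*)) in
    match parent t with
    | None => thin_qr ((hstack ss Y)^t*)
    | Some u =>
      let cs := [seq c' <- dirs_of u | sd_of u c' == c] in
      let* Y' := each cs (fun c' =>
        mul (transfer V t c') ((mx (Z (u, c')))^t*)) in
      thin_qr ((row_mx (hstack ss Y) (hstack cs Y'))^t*)
    end).

(* The result of the truncation at (t, c): the matrix \hat Q_tc, which holds
   the new leaf matrix or the stacked new transfer matrices, and C_tc. *)
Record truncated := Truncated {
  new_height : nat;
  new_rank : nat;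
  new_basis : 'M[R[i]]_(new_height, new_rank);
  change : 'M[R[i]]_(new_rank, k)
}.

Definition truncation (V : cmx) (Z : node -> rowsmx k) :
    comp (node -> truncated) :=
  recursion nodes (fun TV tc => let: (t, c) := tc in
    let* V' :=
      if is_leaf t then ret (pack (basis V t c))
      else
        let* Y := each (enum (chil t)) (fun t' =>
          mul (change (TV (t', sd_of t c))) (transfer V t' c)) in
        ret (pack (vstack (enum (chil t)) Y)) in
    let* A := mul (mx V') ((mx (Z (t, c)))^t*) in
    let* Us := svd A in
    let* r := choose_rank Us.2 in
    let Q := first_cols r Us.1 in
    let* D := mul (Q^t*) (mx V') in
    ret (Truncated Q D)).

Definition adm_leaves : seq (cl * cl * vec3 R) :=
  [seq (tc.1, s, tc.2) | tc <- nodes, s <- enum (row_blocks tc.1 tc.2)].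

Definition projection (S : cl -> cl -> vec3 R -> 'M[R[i]]_k)
    (TV TW : node -> truncated) :
    comp (forall b : cl * cl * vec3 R,
      'M[R[i]]_(new_rank (TV (b.1.1, b.2)), new_rank (TW (b.1.2, b.2)))) :=
  each adm_leaves (fun b =>
    let* D := mul (change (TV (b.1.1, b.2))) (S b.1.1 b.1.2 b.2) in
    mul D ((change (TW (b.1.2, b.2)))^t*)).

Record phase_ops := PhaseOps {
  ops_bw_row : nat; ops_we_row : nat; ops_tr_row : nat;
  ops_bw_col : nat; ops_we_col : nat; ops_tr_col : nat;
  ops_pr : nat
}.

Definition total_ops (n : phase_ops) : nat :=
  (ops_bw_row n + ops_we_row n + ops_tr_row n +
   (ops_bw_col n + ops_we_col n + ops_tr_col n) + ops_pr n)%N.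

(* [n] lists the operation counts of the phases of a run. *)
Definition recompression (V W : cmx)
    (S : cl -> cl -> vec3 R -> 'M[R[i]]_k) (n : phase_ops) : Prop :=
  exists RW ZV TV RV ZW TW St,
  [/\ [/\ basis_weights W RW (ops_bw_row n),
          total_weights row_blocks S V RW ZV (ops_we_row n) &
          truncation V ZV TV (ops_tr_row n)],
      [/\ basis_weights V RV (ops_bw_col n),
          total_weights col_blocks (fun s t c => (S t s c)^t*) W RV ZW
            (ops_we_col n) &
          truncation W ZW TW (ops_tr_col n)] &
      @projection S TV TW St (ops_pr n)].

End Algorithm.

End Setting.

(* Main.v *)
(* Every weight has at most k rows and every truncated rank is at most k, so a
   phase costs O(k^3) per pair (t, c), per admissible leaf, and, for the total
   weights, per block inherited from the parent; only these have to be counted.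
   On one level the squared diameters sum up to at most C_lv |Omega|, hence the
   sum of 1 + kappa^2 diam(B_t)^2 over all clusters is
   O(#I / k + (p + 1) kappa^2).  It bounds the number of pairs through C_di and
   the number of admissible leaves through C_sp. *)
Require Import Defs.
From mathcomp Require Import all_boot all_order all_algebra.
From mathcomp Require Import finmap complex.
From mathcomp Require Import all_classical all_reals all_analysis.
From mathcomp Require Import ring lra.

Import Order.TTheory GRing.Theory Num.Theory.
Local Open Scope ring_scope.

Section Cost.
Set Implicit Arguments.
Unset Strict Implicit.
Variables (R : realType) (I : finType) (X : setting R I).
Local Notation cl := (clusters (tree X)).

(** * Pairs of clusters and directions, levels, and block counts *)

Lemma mem_nodes (t : cl) c : ((t, c) \in nodes X) = (c \in dirs_of t).
Proof.
apply/allpairsPdep/idP => [[t' [c' [_ c't' [-> ->]]]] //|ct].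
by exists t, c; rewrite mem_enum.
Qed.

Lemma sum_nodes (F : cl * vec3 R -> nat) :
  (\sum_(tc <- nodes X) F tc = \sum_t \sum_(c <- dirs_of t) F (t, c))%N.
Proof. by rewrite big_allpairs_dep big_enum. Qed.

Lemma size_nodes : size (nodes X) = (\sum_t #|` dirs_of (X := X) t|)%N.
Proof.
rewrite -sum1_size sum_nodes; apply: eq_bigr => t _.
by rewrite sum1_size.
Qed.

Lemma level_chil (t t' : cl) : t' \in chil t -> level t' = (level t).+1.
Proof. by rewrite inE => /eqP /level_parent. Qed.

Lemma level_le_depth (t : cl) : (level t <= depth (tree X))%N.
Proof. exact: leq_bigmax. Qed.

(** [sd] is constrained only below the depth, and having a child keeps [t] there. This makes
    [(t', sd_of t c)] an entry of [nodes], so that a run specifies the result stored for it. *)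
Lemma sd_chil (t t' : cl) c : wf_setting X -> t' \in chil t ->
  c \in dirs_of t -> sd_of t c \in dirs_of t'.
Proof.
move=> wf t't; rewrite /dirs_of (level_chil t't); apply: sd_dirs => //.
by rewrite -(level_chil t't) level_le_depth.
Qed.

(** The block tree starts at the pair of roots and descends in both cluster trees at once. Hence
    both clusters of a block share one direction set. *)
Lemma block_node_level (t s : cl) c : block_node t s c -> level t = level s.
Proof.
by elim=> // {}t {}s c0 t' s' _ IH _ /level_chil -> /level_chil ->; rewrite IH.
Qed.

Lemma row_blocks_level (t s : cl) c : s \in row_blocks t c -> level t = level s.
Proof. by rewrite inE => /asboolP[/block_node_level]. Qed.

Lemma col_blocks_level (t s : cl) c : s \in col_blocks t c -> level t = level s.
Proof. by rewrite inE => /asboolP[/block_node_level]. Qed.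

Definition block_count (blocks : cl -> vec3 R -> {set cl}) : nat :=
  (\sum_(tc <- nodes X) #|blocks tc.1 tc.2|)%N.

(* The total weights of the column basis run over the column blocks, for which
   no sparsity bound like [known_sp] is available. *)
Lemma block_count_col :
  block_count (col_blocks (X := X)) = block_count (row_blocks (X := X)).
Proof.
(* Cardinalities become sums of 0-1 indicators, so that the two clusters can be exchanged. *)
have count (D : seq (vec3 R)) (P : cl -> vec3 R -> Prop) :
    (\sum_(c <- D) #|[set t | `[< P t c >]]%SET|
     = \sum_t \sum_(c <- D) `[< P t c >])%N.
  rewrite exchange_big /=; apply: eq_bigr => c _.
  by rewrite -sum1dep_card big_mkcond; apply: eq_bigr => t _; case: asboolP.
rewrite /block_count !sum_nodes /=.
under eq_bigr do rewrite count.
under [RHS]eq_bigr do rewrite count.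
rewrite exchange_big /=; apply: eq_bigr => t _; apply: eq_bigr => s _.
(* On equal levels the directions agree; on different levels there is no block and both sums
   vanish. *)
have [ts|ts] := eqVneq (level t) (level s); first by rewrite /dirs_of ts.
by rewrite !big1_seq // => c _; case: asboolP => // -[/block_node_level /eqP];
  rewrite (negPf ts).
Qed.

Lemma size_adm_leaves :
  size (adm_leaves X) = block_count (row_blocks (X := X)).
Proof.
rewrite size_allpairs_dep sumnE big_map; apply: eq_bigr => tc _.
by rewrite cardE.
Qed.

Lemma adm_leaves_dirs b : b \in adm_leaves X ->
  b.2 \in dirs_of b.1.1 /\ b.2 \in dirs_of b.1.2.
Proof.
case/allpairsPdep => -[t c] [s] [/= tcn]; rewrite mem_enum => st ->.
by move: tcn; rewrite !mem_nodes /dirs_of /= (row_blocks_level st).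
Qed.

(* The number of blocks that the weight at (t, c) inherits from the parent. *)
Definition sd_fiber (t : cl) (c : vec3 R) : nat :=
  if parent t is Some u
  then size [seq c' <- dirs_of u | sd_of u c' == c] else 0.

(** For [t] with parent [u], the fibers of [sd_of u] over the directions of [t] are disjoint sets of
    directions of [u]; so the directions of [u] are counted at most once per child. *)
Lemma sum_sd_fiber :
  (\sum_(tc <- nodes X) sd_fiber tc.1 tc.2
   <= \sum_t #|chil t| * #|` dirs_of (X := X) t|)%N.
Proof.
pose F (t : cl) := if parent t is Some u then #|` dirs_of u| else 0%N.
apply: (@leq_trans (\sum_t F t)%N).
  rewrite sum_nodes; apply: leq_sum => t _ /=.
  rewrite /sd_fiber /F; case: (parent t) => [u|]; last by rewrite big1_eq.
  under eq_bigr do rewrite size_filter -sum1_count big_mkcond.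
  rewrite exchange_big /= -[X in (_ <= X)%N]sum1_size.
  apply: leq_sum => c' _; rewrite -big_mkcond sum1_count.
  under eq_count do rewrite eq_sym.
  by rewrite count_uniq_mem ?fset_uniq // leq_b1.
under [X in (_ <= X)%N]eq_bigr do rewrite -sum_nat_const.
rewrite (exchange_big_dep predT) //=; apply: leq_sum => t _.
rewrite /F; case tu: (parent t) => [u|//].
by rewrite (bigD1 u) ?leq_addr // inE tu.
Qed.

(** * Bounds on the numbers of pairs and blocks *)

Variables (C : constants R) (area : R) (k : nat).
Hypotheses (C_pos : constants_pos C) (k_gt0 : (0 < k)%N)
  (wf : wf_setting X) (reg : regular X C k)
  (known : known_consequences X C area k).

Local Notation N := (#|I|%:R / k%:R + (depth (tree X)).+1%:R * kappa X ^+ 2).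

Let Clv_gt0 : 0 < Clv C. Proof. by case: C_pos => _ _ []. Qed.
Let Csp_gt0 : 0 < Csp C. Proof. by case: C_pos => _ _ []. Qed.
Let Cdi_gt0 : 0 < Cdi C. Proof. by case: C_pos => _ []. Qed.
Let Cnc_gt0 : 0 < Cnc C. Proof. by case: C_pos => -[]. Qed.
Let Crs_gt0 : 0 < Crs C. Proof. by case: C_pos => _ []. Qed.
Let Cqr_gt0 : 0 < Cqr C. Proof. by case: C_pos => _ _ _ []. Qed.
Let Csvd_gt0 : 0 < Csvd C. Proof. by case: C_pos => _ _ _ []. Qed.
Let Crk_gt0 : 0 < Crk C. Proof. by case: C_pos => _ _ _ []. Qed.

(* The absolute value keeps this constant positive: it has to be chosen before
   [area] is known to be a measure. *)
Lemma sum_diam2 :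
  \sum_(t : cl) diam (bbox t) ^+ 2
  <= (depth (tree X)).+1%:R * (Clv C * (1 + `|area|)).
Proof.
(* Clusters are grouped by level; [inord] is faithful because no level exceeds the depth. *)
rewrite (partition_big (fun t : cl => inord (level t) : 'I_(depth (tree X)).+1)
  predT) //= mulr_natl -[X in _ *+ X]card_ord -sumr_const.
apply: ler_sum => l _.
have lE (t : cl) : (inord (level t) == l) = (t \in on_level (tree X) l).
  by rewrite inE -val_eqE /= inordK // ltnS level_le_depth.
rewrite (eq_bigl _ _ lE).
have [->|[t0 t0l]] := set_0Vmem (on_level (tree X) l).
  by rewrite big_set0 mulr_ge0 ?addr_ge0 // ltW.
set m := #|on_level (tree X) l|.
have m_gt0 : 0 < m%:R :> R by rewrite ltr0n; apply/card_gt0P; exists t0.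
(* On a level with [m] clusters, [known_level] bounds each squared diameter by an [m]-th of the
   total. *)
apply: (@le_trans _ _ (\sum_(t in on_level (tree X) l)
    Clv C * (1 + `|area|) / m%:R)).
  apply: ler_sum => t tl; rewrite ler_pdivlMr // mulrC.
  apply: le_trans (known_level known tl) _.
  by rewrite ler_wpM2l ?(ltW Clv_gt0) // (le_trans (ler_norm _)) // lerDr.
by rewrite sumr_const -/m -[leLHS]mulr_natr divfK // gt_eqF.
Qed.

Lemma sum_quadratic :
  \sum_(t : cl) (1 + kappa X ^+ 2 * diam (bbox t) ^+ 2)
  <= Clv C * (1 + `|area|) * N.
Proof.
rewrite big_split /= sumr_const -mulr_sumr mulrDr; apply: lerD.
  apply: le_trans (known_lv known) _.
  (* The area factor is at least 1, so inserting it here only enlarges the bound. *)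
  rewrite -mulrA ler_wpM2l ?(ltW Clv_gt0) //.
  by rewrite ler_peMl ?lerDl // divr_ge0.
apply: le_trans (ler_wpM2l (sqr_ge0 _) sum_diam2) _.
by rewrite le_eqVlt; apply/orP; left; apply/eqP; ring.
Qed.

Lemma size_nodes_le :
  (size (nodes X))%:R <= Cdi C * (Clv C * (1 + `|area|) * N).
Proof.
rewrite size_nodes natr_sum.
apply: (le_trans _ (ler_wpM2l (ltW Cdi_gt0) sum_quadratic)).
by rewrite mulr_sumr; apply: ler_sum => t _; apply: (reg_di reg).
Qed.

Lemma block_count_row_le : (block_count (row_blocks (X := X)))%:R
  <= Csp C * (Clv C * (1 + `|area|) * N).
Proof.
rewrite /block_count sum_nodes natr_sum.
apply: (le_trans _ (ler_wpM2l (ltW Csp_gt0) sum_quadratic)).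
rewrite mulr_sumr; apply: ler_sum => t _.
(* The first branch is absorbed by the summand 1, the second by the quadratic one. *)
apply: le_trans (known_sp known t) _; case: ifP => _.
  by rewrite ler_peMr ?(ltW Csp_gt0) // lerDl mulr_ge0 ?sqr_ge0.
by rewrite ler_wpM2l ?(ltW Csp_gt0) // lerDr.
Qed.

Lemma sum_sd_fiber_le :
  (\sum_(tc <- nodes X) sd_fiber tc.1 tc.2)%:R
  <= Cnc C * (size (nodes X))%:R.
Proof.
apply: (@le_trans _ _ (\sum_t #|chil t| * #|` dirs_of (X := X) t|)%N%:R).
  by rewrite ler_nat sum_sd_fiber.
rewrite size_nodes !natr_sum mulr_sumr; apply: ler_sum => t _.
by rewrite natrM ler_wpM2r // (reg_nc reg).
Qed.

(** * Costs and dimensions of the elementary computations *)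

Lemma each_ops (J : eqType) (s : seq J) (A : J -> Type)
    (f : forall j, Defs.comp (A j)) a n (b : J -> R) :
    each s f a n ->
    (forall j m, j \in s -> f j (a j) m -> m%:R <= b j) ->
  n%:R <= \sum_(j <- s) b j.
Proof.
case=> cost fa -> fb; rewrite natr_sum big_seq [leRHS]big_seq.
by apply: ler_sum => j js; apply/fb/fa.
Qed.

Lemma each_ops_const (J : eqType) (s : seq J) (A : J -> Type)
    (f : forall j, Defs.comp (A j)) a n (b : R) :
    each s f a n ->
    (forall j m, j \in s -> f j (a j) m -> m%:R <= b) ->
  n%:R <= (size s)%:R * b.
Proof.
move=> fa fb; apply: le_trans (each_ops fa fb) _.
by rewrite big_const_seq count_predT iter_addr_0 mulr_natl.
Qed.

(** A finished run carries the specification of every single entry, so properties of one result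
    follow without induction over the tree. *)
Lemma each_fun (J : eqType) (s : seq J) (A : J -> Type)
    (f : forall j, Defs.comp (A j)) a n j :
  each s f a n -> j \in s -> exists m, f j (a j) m.
Proof. by case=> cost fa _ /fa; exists (cost j). Qed.

(** The dimension bounds are real numbers because they involve constants such as [Cnc C] and
    [Crs C]. *)
Lemma mul_ops m n p (A : 'M[R[i]]_(m, n)) (B : 'M[R[i]]_(n, p)) D ops (x y z : R) :
    Defs.mul A B D ops -> m%:R <= x -> n%:R <= y -> p%:R <= z ->
  ops%:R <= 2 * (x * y * z).
Proof.
case=> _ ops_le mx ny pz; apply: (@le_trans _ _ (2 * m * n * p)%N%:R).
  by rewrite ler_nat.
by rewrite !natrM -!mulrA ler_wpM2l // !ler_pM ?mulr_ge0.
Qed.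

Lemma thin_qr_ops m (A : 'M[R[i]]_(m, k)) D ops (x : R) :
  thin_qr C A D ops -> m%:R <= x -> ops%:R <= Cqr C * (x * k%:R * k%:R).
Proof.
case=> _ _ /le_trans ops_le mx; apply: ops_le.
rewrite ler_wpM2l ?(ltW Cqr_gt0) // !natrM ler_pM ?mulr_ge0 //.
  by rewrite ler_wpM2r.
by rewrite ler_nat geq_minr.
Qed.

Lemma thin_qr_rows m (A : 'M[R[i]]_(m, k)) D ops :
  thin_qr C A D ops -> (rows D)%:R <= k%:R :> R.
Proof. by case=> rD _ _; rewrite rD ler_nat geq_minr. Qed.

Lemma svd_ops m n (A : 'M[R[i]]_(m, n)) Us ops (x : R) :
  svd C A Us ops -> m%:R <= x -> n%:R <= k%:R :> R ->
  ops%:R <= Csvd C * (x * k%:R * k%:R).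
Proof.
case=> _ _ _ _ /le_trans ops_le mx nk; apply: ops_le.
rewrite ler_wpM2l ?(ltW Csvd_gt0) // !natrM !ler_pM ?mulr_ge0 //.
by apply: le_trans nk; rewrite ler_nat geq_minr.
Qed.

(** The sum on the left is the number of rows of a [vstack], or of columns of an [hstack]. *)
Lemma stack_dim (J : eqType) (s : seq J) (r : J -> nat) :
    (forall j, j \in s -> (r j)%:R <= k%:R :> R) ->
  (\sum_(i < size s) r (tnth (in_tuple s) i))%N%:R <= (size s)%:R * k%:R :> R.
Proof.
move=> rk; rewrite natr_sum mulr_natl -[X in _ *+ X]card_ord -sumr_const.
by apply: ler_sum => i _; apply: rk; rewrite mem_tnth.
Qed.

(** * Dimensions and costs in the four phases *)

Local Notation K := (k%:R : R).

Let K3_ge0 : 0 <= K ^+ 3. Proof. exact: exprn_ge0. Qed.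

Lemma size_chil_le (t : cl) : (size (enum (chil t)))%:R <= Cnc C.
Proof. by rewrite -cardE; exact: (reg_nc reg). Qed.

Lemma label_leaf_le (t : cl) : is_leaf t -> #|label t|%:R <= Crs C * K.
Proof. by case/(reg_rs reg)/andP. Qed.

Lemma stack_chil_dim (t : cl) (r : cl -> nat) :
  (forall t', t' \in chil t -> (r t')%:R <= K) ->
  (\sum_(i < size (enum (chil t))) r (tnth (in_tuple (enum (chil t))) i))%N%:R
  <= Cnc C * K.
Proof.
move=> rk; apply: le_trans (stack_dim (r := r) _) _.
  by move=> t'; rewrite mem_enum; apply: rk.
by rewrite ler_wpM2r // size_chil_le.
Qed.

(** Every weight is the R-factor of a matrix with [k] columns, which alone limits its number of
    rows. *)
Lemma basis_weights_rows (W : cluster_basis X k) RW n t c :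
  basis_weights C W RW n -> c \in dirs_of t -> (rows (RW (t, c)))%:R <= K.
Proof.
move=> run; rewrite -mem_nodes => /(each_fun run)[m] /=.
by case: ifP => _; [|case=> Y [m1 [m2 [_ + _]]]]; apply: thin_qr_rows.
Qed.

Lemma basis_weights_ops (W : cluster_basis X k) RW n :
  basis_weights C W RW n ->
  n%:R <= (size (nodes X))%:R * ((Cqr C * Crs C + (2 + Cqr C) * Cnc C) * K ^+ 3).
Proof.
move=> run; apply: (each_ops_const run) => -[t c] m; rewrite mem_nodes => ct /=.
(* The constant adds up the leaf and the non-leaf case. To drop the terms of the other case, [lra]
   needs these nonlinear products as nonnegative atoms. *)
have QS_ge0 := mulr_ge0 (mulr_ge0 (ltW Cqr_gt0) (ltW Crs_gt0)) K3_ge0.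
have QN_ge0 := mulr_ge0 (mulr_ge0 (ltW Cqr_gt0) (ltW Cnc_gt0)) K3_ge0.
have N3_ge0 := mulr_ge0 (ltW Cnc_gt0) K3_ge0.
case: ifPn => [leaf|_].
  move/thin_qr_ops=> /(_ _ (label_leaf_le leaf)); lra.
case=> Y [m1 [m2 [runY qr ->]]]; rewrite natrD.
have rk t' : t' \in chil t -> (rows (RW (t', sd_of t c)))%:R <= K.
  by move=> t't; apply: (basis_weights_rows run); exact: sd_chil ct.
have {qr} := thin_qr_ops qr (stack_chil_dim rk).
have {runY} m1_le : m1%:R <= Cnc C * (2 * (K * K * K)).
  apply: le_trans (each_ops_const (b := 2 * (K * K * K)) runY _) _; last first.
    by rewrite ler_wpM2r ?size_chil_le ?mulr_ge0.
  by move=> t' m'; rewrite mem_enum => /rk t'k /mul_ops; apply.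
move: m1_le; lra.
Qed.

Lemma total_weights_rows (blocks : cl -> vec3 R -> {set cl}) S (V : cluster_basis X k)
    RW Z n t c :
    total_weights C blocks S V RW Z n -> c \in dirs_of t ->
  (rows (Z (t, c)))%:R <= K.
Proof.
move=> run; rewrite -mem_nodes => /(each_fun run)[m] /=.
case=> Y [m1 [m2 [_ + _]]]; case: (parent t) => [u|]; last exact: thin_qr_rows.
by case=> Y' [m3 [m4 [_ + _]]]; apply: thin_qr_rows.
Qed.

(** Each own or inherited block costs one product, at most [2 * K ^+ 3], and adds at most [k] rows
    to the matrix of the QR factorization, hence [Cqr C * K ^+ 3] to the bound on its cost. *)
Lemma total_weights_ops (blocks : cl -> vec3 R -> {set cl}) S (V : cluster_basis X k)
    RW Z n :
    (forall t s c, s \in blocks t c -> level t = level s) ->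
    (forall t c, c \in dirs_of t -> (rows (RW (t, c)))%:R <= K) ->
    total_weights C blocks S V RW Z n ->
  n%:R <= ((block_count blocks)%:R + Cnc C * (size (nodes X))%:R) *
    ((2 + Cqr C) * K ^+ 3).
Proof.
move=> blocks_level rowsRW run.
pose b (tc : cl * vec3 R) : R :=
  (#|blocks tc.1 tc.2|%:R + (sd_fiber tc.1 tc.2)%:R) * ((2 + Cqr C) * K ^+ 3).
apply: (@le_trans _ _ (\sum_(tc <- nodes X) b tc)); last first.
  rewrite /b -mulr_suml ler_wpM2r ?mulr_ge0 ?addr_ge0 ?(ltW Cqr_gt0) //.
  rewrite big_split /= -!natr_sum lerD2l; exact: sum_sd_fiber_le.
apply: (each_ops run) => -[t c] m; rewrite mem_nodes => ct.
rewrite /b /sd_fiber /=.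
(* Equal levels give equal direction sets, so the row bound on [RW] applies at [(s, c)]. *)
have rk s : s \in enum (blocks t c) -> (rows (RW (s, c)))%:R <= K.
  rewrite mem_enum => /blocks_level ts; apply: rowsRW.
  by rewrite /dirs_of -ts.
case=> Y [m1 [m2 [runY + ->]]]; rewrite natrD cardE.
have {runY} : m1%:R <= (size (enum (blocks t c)))%:R * (2 * (K * K * K)).
  by apply: (each_ops_const runY) => s m' /rk sk /mul_ops; apply.
have dim := stack_dim rk.
case tu: (parent t) => [u|]; last first.
  by move=> m1_le /thin_qr_ops /(_ dim); move: m1_le; lra.
set cs := [seq c' <- _ | _].
move=> m1_le [Y' [m3 [m4 [runY' qr ->]]]]; rewrite natrD.
have rk' c' : c' \in cs -> (rows (Z (u, c')))%:R <= K.
  by rewrite mem_filter => /andP[_]; apply: total_weights_rows run.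
have {runY'} : m3%:R <= (size cs)%:R * (2 * (K * K * K)).
  by apply: (each_ops_const runY') => c' m' /rk' c'k /mul_ops; apply.
have := thin_qr_ops (x := (size (enum (blocks t c)))%:R * K + (size cs)%:R * K) qr.
rewrite natrD lerD ?(stack_dim rk') // => /(_ isT).
move: m1_le; lra.
Qed.

(** The rank is at most the number of singular values, hence at most the number of rows of the total
    weight. *)
Lemma truncation_rank (V : cluster_basis X k) Z TV n t c :
    (forall t c, c \in dirs_of t -> (rows (Z (t, c)))%:R <= K) ->
    truncation C V Z TV n -> c \in dirs_of t ->
  (new_rank (TV (t, c)))%:R <= K.
Proof.
move=> rowsZ run ct; apply: le_trans (rowsZ _ _ ct); rewrite ler_nat.
move: ct; rewrite -mem_nodes => /(each_fun run)[m] /=.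
case=> V' [m1 [m2 [_ + _]]]; case=> A [m3 [m4 [_ + _]]].
case=> Us [m5 [m6 [_ + _]]]; case=> r [m7 [m8 [_ + _]]].
case=> D [m9 [m10 [_ [-> _] _]]] /=.
by rewrite (leq_trans (leq_ord r)) // geq_minr.
Qed.

(** The summand [2 * Cnc C] pays for the products with transfer matrices, [4] for forming [A] and
    [D], [Csvd C] for the decomposition and [Crk C] for the rank choice. *)
Lemma truncation_ops (V : cluster_basis X k) Z TV n :
    (forall t c, c \in dirs_of t -> (rows (Z (t, c)))%:R <= K) ->
    truncation C V Z TV n ->
  n%:R <= (size (nodes X))%:R *
    ((2 * Cnc C + (4 + Csvd C) * (Crs C + Cnc C) + Crk C) * K ^+ 3).
Proof.
move=> rowsZ run; apply: (each_ops_const run) => -[t c] m.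
rewrite mem_nodes => ct /=.
(* [x] bounds the rows of [V'] both for a leaf ([Crs C * K]) and for a stack over children
   ([Cnc C * K]). *)
set x := (Crs C + Cnc C) * K.
case=> V' [m1 [m2 [runV' + ->]]].
have {runV'} [V'_rows m1_le] :
    (rows V')%:R <= x /\ m1%:R <= Cnc C * (2 * (K * K * K)).
  move: runV'; case: ifPn => [leaf [-> ->]|_].
    split; last by rewrite !mulr_ge0 // ltW.
    apply: le_trans (label_leaf_le leaf) _.
    by rewrite ler_wpM2r // lerDl ltW.
  case=> Y [n1 [n2 [runY [-> ->] ->]]]; rewrite addn0.
  have rk t' : t' \in chil t -> (new_rank (TV (t', sd_of t c)))%:R <= K.
    by move=> t't; apply: (truncation_rank rowsZ run); exact: sd_chil ct.
  split.
    apply: le_trans (stack_chil_dim rk) _.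
    by rewrite ler_wpM2r // lerDr ltW.
  apply: le_trans (each_ops_const (b := 2 * (K * K * K)) runY _) _; last first.
    by rewrite ler_wpM2r ?size_chil_le ?mulr_ge0.
  by move=> t' m'; rewrite mem_enum => /rk t'k /mul_ops; apply.
case=> A [m3 [m4 [/mul_ops/(_ V'_rows (lexx _) (rowsZ _ _ ct)) m3_le + ->]]].
case=> Us [m5 [m6 [/svd_ops/(_ V'_rows (rowsZ _ _ ct)) m5_le + ->]]].
case=> r [m7 [m8 [m7_le + ->]]].
case=> D [m9 [m10 [runD [_ ->] ->]]]; rewrite addn0 !natrD.
have rk : r%:R <= K.
  apply: le_trans (rowsZ _ _ ct); rewrite ler_nat.
  by rewrite (leq_trans (leq_ord r)) // geq_minr.
have m9_le := mul_ops runD rk V'_rows (lexx _).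
have K1 : 1 <= K by rewrite ler1n.
(* Choosing the rank costs only order [k], which is at most order [k^3] since [k >= 1]. *)
have KK3 : Crk C * K <= Crk C * K ^+ 3.
  by rewrite ler_wpM2l ?(ltW Crk_gt0) // ler_eXnr.
have {}m7_le : m7%:R <= Crk C * K ^+ 3 := le_trans m7_le KK3.
move: m1_le m3_le m5_le m7_le m9_le; rewrite /x; lra.
Qed.

(** Each admissible leaf requires two products with all dimensions at most [k], whence the factor
    4. *)
Lemma projection_ops (S : cl -> cl -> vec3 R -> 'M[R[i]]_k)
    (TV TW : cl * vec3 R -> truncated R k) St n :
    (forall t c, c \in dirs_of t -> (new_rank (TV (t, c)))%:R <= K) ->
    (forall t c, c \in dirs_of t -> (new_rank (TW (t, c)))%:R <= K) ->
    projection S (TV := TV) (TW := TW) St n ->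
  n%:R <= (block_count (row_blocks (X := X)))%:R * (4 * K ^+ 3).
Proof.
move=> rkV rkW run; rewrite -size_adm_leaves.
apply: (each_ops_const run) => -[[t s] c] m /adm_leaves_dirs /= [] /rkV tk /rkW sk.
case=> D [m1 [m2 [/mul_ops m1_le /mul_ops m2_le ->]]]; rewrite natrD.
move: (m1_le _ _ _ tk (lexx _) (lexx _)) (m2_le _ _ _ tk (lexx _) sk); lra.
Qed.

End Cost.


(** * Choice of the constants and summation over the phases *)

Theorem theorem13 (R : realType) (C : constants R) (area : R) :
  constants_pos C ->
  exists Cbw Cwe Ctr Cpr : R,
  [/\ 0 < Cbw, 0 < Cwe, 0 < Ctr & 0 < Cpr] /\
  forall (I : finType) (X : setting R I) (k : nat)
    (G : I -> I -> R[i]) (V W : cluster_basis X k)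
    (S : clusters (tree X) -> clusters (tree X) -> vec3 R -> 'M[R[i]]_k)
    (n : phase_ops),
  (0 < k)%N ->
  wf_setting X ->
  surface_measure (Omega X) = area%:E ->
  regular X C k ->
  known_consequences X C area k ->
  is_directional V ->
  is_directional W ->
  is_dh2 G V W S ->
  recompression C V W S n ->
  let N := k%:R ^+ 3 *
    (#|I|%:R / k%:R + (depth (tree X)).+1%:R * kappa X ^+ 2) in
  [/\ (ops_bw_row n)%:R <= Cbw * N /\ (ops_bw_col n)%:R <= Cbw * N,
      (ops_we_row n)%:R <= Cwe * N /\ (ops_we_col n)%:R <= Cwe * N,
      (ops_tr_row n)%:R <= Ctr * N /\ (ops_tr_col n)%:R <= Ctr * N,
      (ops_pr n)%:R <= Cpr * N &
      (total_ops n)%:R <= (2 * Cbw + 2 * Cwe + 2 * Ctr + Cpr) * N].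
Proof.
move=> C_pos.
case: (C_pos) => -[cp nc cu cl ov] [lf rs un di] [sp lv] [qr svd rk].
have a_gt0 : 0 < Clv C * (1 + `|area|) by rewrite mulr_gt0 // ltr_wpDr.
pose a := Clv C * (1 + `|area|).
pose cbw := Cqr C * Crs C + (2 + Cqr C) * Cnc C.
pose ctr := 2 * Cnc C + (4 + Csvd C) * (Crs C + Cnc C) + Crk C.
(* Up to the factor [#I / k + (p + 1) kappa^2], [Cdi C * a] bounds the number of pairs, [Csp C * a]
   that of blocks and [Cnc C * Cdi C * a] that of inherited blocks. The remaining factors are costs
   per item in units of [k^3]. *)
exists (Cdi C * a * cbw), ((Csp C + Cnc C * Cdi C) * a * (2 + Cqr C)),
  (Cdi C * a * ctr), (4 * Csp C * a).
split.
  by rewrite /cbw /ctr; split;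
    repeat first [done | apply: mulr_gt0 | apply: addr_gt0].
move=> I X k G V W S n k_gt0 wf _ reg known _ _ _.
case=> RW [ZV] [TV] [RV] [ZW] [TW] [St].
case=> -[bwW weV trV] [bwV weW trW] pr N.
pose e : R := #|I|%:R / k%:R + (depth (tree X)).+1%:R * kappa X ^+ 2.
have K3_ge0 : 0 <= k%:R ^+ 3 :> R by exact: exprn_ge0.
have M_le := size_nodes_le C_pos reg known.
have B_le := block_count_row_le C_pos known.
have bw (W' : cluster_basis X k) RW' m :
    basis_weights C W' RW' m -> m%:R <= Cdi C * a * cbw * N.
  move=> run; apply: le_trans (basis_weights_ops C_pos wf reg run) _.
  rewrite -/cbw [leRHS](_ : _ =
    Cdi C * (a * e) * (cbw * k%:R ^+ 3)); last by rewrite /N /e; ring.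
  by rewrite ler_wpM2r ?mulr_ge0 // ltW // /cbw ?(addr_gt0, mulr_gt0).
(* Stated for any block sets with the same total count, this serves the row basis and, through
   [block_count_col], the column basis. *)
have we (blocks : clusters (tree X) -> vec3 R -> {set clusters (tree X)})
    S' (V' : cluster_basis X k) RW' Z m :
    (forall t s c, s \in blocks t c -> level t = level s) ->
    block_count blocks = block_count (row_blocks (X := X)) ->
    (forall t c, c \in dirs_of t -> (rows (RW' (t, c)))%:R <= k%:R :> R) ->
    total_weights C blocks S' V' RW' Z m ->
  m%:R <= (Csp C + Cnc C * Cdi C) * a * (2 + Cqr C) * N.
  move=> blocks_level blocksE rowsRW run.
  apply: le_trans (total_weights_ops C_pos reg blocks_level rowsRW run) _.
  rewrite blocksE [leRHS](_ : _ =
    (Csp C * (a * e) + Cnc C * (Cdi C * (a * e))) *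
    ((2 + Cqr C) * k%:R ^+ 3)); last by rewrite /N /e; ring.
  rewrite ler_wpM2r ?mulr_ge0 ?addr_ge0 ?(ltW qr) //.
  by rewrite lerD // ler_wpM2l // ltW.
have tr (V' : cluster_basis X k) Z TV' m :
    (forall t c, c \in dirs_of t -> (rows (Z (t, c)))%:R <= k%:R :> R) ->
    truncation C V' Z TV' m -> m%:R <= Cdi C * a * ctr * N.
  move=> rowsZ run; apply: le_trans (truncation_ops C_pos k_gt0 wf reg rowsZ run) _.
  rewrite -/ctr [leRHS](_ : _ =
    Cdi C * (a * e) * (ctr * k%:R ^+ 3)); last by rewrite /N /e; ring.
  rewrite ler_wpM2r ?mulr_ge0 // ltW // /ctr.
  by repeat first [done | apply: mulr_gt0 | apply: addr_gt0].
have rowsRW t c := basis_weights_rows (t := t) (c := c) bwW.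
have rowsRV t c := basis_weights_rows (t := t) (c := c) bwV.
have rowsZV t c := total_weights_rows (t := t) (c := c) weV.
have rowsZW t c := total_weights_rows (t := t) (c := c) weW.
have rankTV t c := truncation_rank (t := t) (c := c) rowsZV trV.
have rankTW t c := truncation_rank (t := t) (c := c) rowsZW trW.
have [bw1 bw2] := (bw _ _ _ bwW, bw _ _ _ bwV).
have we1 := we _ _ _ _ _ _ (@row_blocks_level _ _ X) erefl rowsRW weV.
have we2 := we _ _ _ _ _ _ (@col_blocks_level _ _ X) (block_count_col X)
  rowsRV weW.
have [tr1 tr2] := (tr _ _ _ _ rowsZV trV, tr _ _ _ _ rowsZW trW).
have pr1 : (ops_pr n)%:R <= 4 * Csp C * a * N.
  apply: le_trans (projection_ops rankTV rankTW pr) _.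
  rewrite [leRHS](_ : _ =
    Csp C * (a * e) * (4 * k%:R ^+ 3)); last by rewrite /N /e; ring.
  by rewrite ler_wpM2r ?mulr_ge0.
split=> //; rewrite /total_ops !natrD.
apply: le_trans (lerD (lerD (lerD (lerD bw1 we1) tr1)
  (lerD (lerD bw2 we2) tr2)) pr1) _.
by rewrite le_eqVlt; apply/orP; left; apply/eqP; ring.
Qed.
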